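(* Let $k\geq 2$ be an integer and let $G_l(q)$, $l\geq 1$, be the sequence of formal series defined in the context. Then for every $j\geq 0$ and every $i\in\{1,\dots,k\}$, $$G_{(k-1)j+i}(q)=\frac{1}{F(q)}\sum_{n\geq 0}\frac{(-1)^n q^{4k\binom{n}{2}+(2k(j+1)+2i-1)n}\prod_{t=1}^{j}\bigl(1-q^{2(n+t)}\bigr)}{\prod_{t=0}^{j}\bigl(1+q^{2(n+t)+1}\bigr)}\cdot\Bigl(1-q^{2(k-i+1)(2n+j+1)}+q^{2(n+j)+1}\bigl(1-q^{2(k-i)(2n+j+1)}\bigr)\Bigr),$$ where each factor $(1+q^{a})^{-1}$ is expanded as a formal power series in $q$ and the empty product (for $j=0$) equals $1$.
   Context: $q$ is a formal variable and all series are formal (Laurent) series in $q$. Fix an integer $k\geq 2$. Let $F(q)=\prod_{m\geq 1,\ m\not\equiv 2 \pmod 4}(1-q^m)$. For $1\leq i\leq k$ define $$G_i(q)=\prod_{\substack{m\geq 1,\ m\not\equiv 2\ (\mathrm{mod}\ 4),\\ m\not\equiv 0,\ 2k+(2i-1),\ 2k-(2i-1)\ (\mathrm{mod}\ 4k)}}(1-q^m)^{-1}.$$ Every integer $l\geq k+1$ can be written uniquely as $l=(k-1)j+i$ with $j\geq 1$ and $2\leq i\leq k$ (note that $(k-1)j+1=(k-1)(j-1)+k$, so the indices $(k-1)j+1,\dots,(k-1)j+k$, the ''$j$-th shelf'', overlap consecutive shelves in one index). For such $l$ define recursively $$G_{(k-1)j+i}(q)=\frac{G_{(k-1)(j-1)+k-i+1}(q)-G_{(k-1)(j-1)+k-i+2}(q)}{q^{2j(i-1)}}-q^{-1}G_{(k-1)j+i-1}(q),$$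 the right-hand side involving only indices smaller than $(k-1)j+i$. *)

(* Defs.v *)
From HB Require Import structures.
From mathcomp Require Import all_boot all_order all_algebra.
From mathcomp Require Import all_classical.
From mathcomp Require Import zify.

Set Implicit Arguments.
Unset Strict Implicit.
Unset Printing Implicit Defensive.

Import Order.TTheory GRing.Theory Num.Theory.
Local Open Scope ring_scope.

(* The ring R((q)) of formal Laurent series: a series is its family of        *)
(* coefficients, indexed by int, vanishing below some degree.                 *)

Record laurent (R : comNzRingType) := Laurent {
  lcoef :> int -> R;
  lcoef_bounded : exists b : int, forall n : int, n < b -> lcoef n = 0
}.

HB.instance Definition _ (R : comNzRingType) := gen_eqMixin (laurent R).
HB.instance Definition _ (R : comNzRingType) := gen_choiceMixin (laurent R).

Section LaurentRing.
Variable R : comNzRingType.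
Implicit Types (x y z : laurent R) (a b n : int).

Lemma laurentP x y : (forall n, x n = y n) -> x = y.
Proof.
case: x y => [f hf] [g hg] /= fg.
have e : f = g by apply/funext.
by case: _ / e hg => hg; congr Laurent; exact: Prop_irrelevance.
Qed.

Lemma lmono_bounded (m : int) :
  exists b : int, forall n : int, n < b -> (n == m)%:R = 0 :> R.
Proof. by exists m => n nm; rewrite lt_eqF. Qed.

Definition lmono (m : int) : laurent R :=
  Laurent (lmono_bounded m).

Lemma lzero_bounded : exists b : int, forall n : int, n < b -> 0 = 0 :> R.
Proof. by exists 0. Qed.

Definition lzero : laurent R := Laurent lzero_bounded.

Lemma ladd_bounded x y :
  exists b : int, forall n : int, n < b -> x n + y n = 0.
Proof.
have [a xa] := lcoef_bounded x; have [b yb] := lcoef_bounded y.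
exists (Num.min a b) => n; rewrite lt_min => /andP[na nb].
by rewrite xa // yb // addr0.
Qed.

Definition ladd x y : laurent R := Laurent (ladd_bounded x y).

Lemma lopp_bounded x : exists b : int, forall n : int, n < b -> - x n = 0.
Proof.
by have [a xa] := lcoef_bounded x; exists a => n na; rewrite xa // oppr0.
Qed.

Definition lopp x : laurent R := Laurent (lopp_bounded x).

(* The sum below has finite support, since x and y vanish in low degrees.     *)
Definition lconv x y (n : int) : R :=
  (\sum_(i \in [set: int]) (x i * y (n - i))).

Lemma lconvE x y a (K : nat) n :
  (forall i, i < a -> x i = 0) ->
  (forall i, i >= a + K%:Z -> y (n - i) = 0) ->
  lconv x y n = \sum_(i < K) x (a + i%:Z) * y (n - (a + i%:Z)).
Proof.
move=> xa yK; rewrite /lconv.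
have injf : injective (fun i : nat => a + i%:Z) by move=> i j /addrI [].
rewrite (fsbigE [seq a + i%:Z | i : nat <- iota 0 K]).
- rewrite big_map; under eq_bigl do rewrite in_setT.
  by rewrite -(big_mkord xpredT (fun i : nat => x (a + i%:Z) * y (n - (a + i%:Z))))
    /index_iota subn0.
- by rewrite map_inj_uniq // iota_uniq.
- by [].
- move=> i _ /negP iNr.
  have [ia|ai] := ltP i a; first by rewrite xa // mul0r.
  have [iK|Ki] := ltP i (a + K%:Z); last by rewrite yK // mulr0.
  exfalso; apply: iNr; apply/mapP; exists (absz (i - a)%R); last by lia.
  by rewrite mem_iota; lia.
Qed.

Lemma lmul_bounded x y :
  exists b : int, forall n : int, n < b -> lconv x y n = 0.
Proof.
have [a xa] := lcoef_bounded x; have [b yb] := lcoef_bounded y.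
exists (a + b) => n nab; rewrite (@lconvE _ _ a 0) ?big_ord0 // => i ai.
by apply: yb; lia.
Qed.

Definition lmul x y : laurent R := Laurent (lmul_bounded x y).

Lemma laddA : associative ladd.
Proof. by move=> x y z; apply: laurentP => n /=; rewrite addrA. Qed.

Lemma laddC : commutative ladd.
Proof. by move=> x y; apply: laurentP => n /=; rewrite addrC. Qed.

Lemma ladd0 : left_id lzero ladd.
Proof. by move=> x; apply: laurentP => n /=; rewrite add0r. Qed.

Lemma laddN : left_inverse lzero lopp ladd.
Proof. by move=> x; apply: laurentP => n /=; rewrite addNr. Qed.

HB.instance Definition _ :=
  GRing.isZmodule.Build (laurent R) laddA laddC ladd0 laddN.

Lemma lmulC : commutative lmul.
Proof.
move=> x y; apply: laurentP => n /=; rewrite /lconv.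
rewrite (reindex_fsbigT (fun i : int => n - i)); last first.
  by exists (fun i : int => n - i) => i; lia.
by apply: eq_fsbigr => i _; rewrite mulrC; congr (y _ * _); lia.
Qed.

Lemma lmulA : associative lmul.
Proof.
move=> x y z; apply: laurentP => n.
have [a xa] := lcoef_bounded x; have [b yb] := lcoef_bounded y.
have [c zc] := lcoef_bounded z.
have xyab : forall i, i < a + b -> lmul x y i = 0.
  move=> i iab /=; rewrite (@lconvE _ _ a 0) ?big_ord0 // => j aj.
  by apply: yb; lia.
have [K hK] : exists K : nat, n - a - b - c < K%:Z.
  by exists (absz (n - a - b - c)%R).+1; lia.
rewrite [LHS](@lconvE x (lmul y z) a K) //; last first.
  move=> i ai /=; rewrite (@lconvE _ _ b 0) ?big_ord0 // => j bj.
  by apply: zc; lia.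
rewrite [RHS](@lconvE (lmul x y) z (a + b) K) //; last first.
  by move=> i abi; apply: zc; lia.
under eq_bigr => s _.
  rewrite /= (@lconvE y z (b - s%:Z) K); last first.
  - by move=> i ib; apply: zc; lia.
  - by move=> i ib; apply: yb; lia.
  rewrite mulr_sumr; over.
rewrite exchange_big /=; apply: eq_bigr => i _.
rewrite (@lconvE x y a K) ?mulr_suml //; last first.
  by move=> j aj; apply: yb; have := ltn_ord i; lia.
apply: eq_bigr => s _; rewrite mulrA.
by congr (_ * y _ * z _); lia.
Qed.

Lemma lmul1 : left_id (lmono 0) lmul.
Proof.
move=> x; apply: laurentP => n /=; rewrite /lconv (fsbigE [:: 0]) //.
  by rewrite big_cons big_nil in_setT /= mul1r subr0 addr0.
by move=> i _; rewrite inE /= => /negPf ->; rewrite mul0r.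
Qed.

Lemma lmulDl : left_distributive lmul ladd.
Proof.
move=> x y z; apply: laurentP => n.
have [a xa] := lcoef_bounded x; have [b yb] := lcoef_bounded y.
have [c zc] := lcoef_bounded z; pose d := Num.min a b.
have da : d <= a by rewrite ge_min lexx.
have db : d <= b by rewrite ge_min lexx orbT.
have xd i : i < d -> x i = 0 by move=> id; apply: xa; lia.
have yd i : i < d -> y i = 0 by move=> id; apply: yb; lia.
have [K hK] : exists K : nat, n - d - c < K%:Z.
  by exists (absz (n - d - c)%R).+1; lia.
have zd i : d + K%:Z <= i -> z (n - i) = 0 by move=> id; apply: zc; lia.
rewrite /= !(@lconvE _ _ d K) // => [|i id]; last by rewrite /= xd ?yd ?addr0.
by rewrite -big_split; apply: eq_bigr => i _; rewrite mulrDl.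
Qed.

Lemma lone_neq0 : lmono 0 != lzero.
Proof.
apply/eqP => /(congr1 (fun x : laurent R => x 0)) /= /eqP.
by rewrite oner_eq0.
Qed.

HB.instance Definition _ := GRing.Zmodule_isComNzRing.Build (laurent R)
  lmulA lmulC lmul1 lmulDl lone_neq0.

(* x^-1 is the (necessarily unique) multiplicative inverse of x in R((q))     *)
(* when it exists, and x otherwise.                                           *)
Definition lunit : {pred laurent R} := fun x => `[< exists y, y * x = 1 >].

Definition linv x : laurent R := xget x [set y | y * x = 1].

Lemma lmulVx : {in lunit, left_inverse 1 linv *%R}.
Proof. by move=> x /asboolP ex; exact: (@xgetPex _ x [set y | y * x = 1]). Qed.

Lemma lunitPl x y : y * x = 1 -> lunit x.
Proof. by move=> yx; apply/asboolP; exists y. Qed.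

Lemma linv_out : {in [predC lunit], linv =1 id}.
Proof.
move=> x /negP nx; rewrite /linv; case: xgetP => // y _ yx.
by case: nx; exact: lunitPl yx.
Qed.

HB.instance Definition _ := GRing.ComNzRing_hasMulInverse.Build (laurent R)
  lmulVx lunitPl linv_out.

Lemma lcoefD x y n : (x + y) n = x n + y n. Proof. by []. Qed.
Lemma lcoefN x n : (- x) n = - x n. Proof. by []. Qed.
Lemma lcoef0 n : (0 : laurent R) n = 0. Proof. by []. Qed.
Lemma lcoef1 n : (1 : laurent R) n = (n == 0)%:R. Proof. by []. Qed.
Lemma lcoefM x y n :
  (x * y) n = \sum_(i \in [set: int]) (x i * y (n - i)).
Proof. by []. Qed.

Lemma lmonoM (m p : int) : lmono m * lmono p = lmono (m + p).
Proof.
apply: laurentP => n; rewrite lcoefM (fsbigE [:: m]) //.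
  rewrite big_cons big_nil in_setT /= eqxx mul1r addr0.
  by congr (nat_of_bool _)%:R; lia.
by move=> i _; rewrite inE /= => /negPf ->; rewrite mul0r.
Qed.

(* Limits are taken in the q-adic topology: for every n, the coefficients of  *)
(* degree at most n are eventually constant. llim u is 0 if u diverges, which *)
(* by lcauchy_cvg never happens for a q-adically Cauchy sequence.             *)
Definition lcvg (u : nat -> laurent R) x : Prop :=
  forall n : int, exists N0 : nat, forall N : nat, (N0 <= N)%N ->
  forall m : int, m <= n -> u N m = x m.

Definition llim (u : nat -> laurent R) : laurent R := xget 0 [set x | lcvg u x].

Lemma lcvg_unique (u : nat -> laurent R) x y : lcvg u x -> lcvg u y -> x = y.
Proof.
move=> ux uy; apply: laurentP => n.
have [N hN] := ux n; have [M hM] := uy n.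
by rewrite -(hN (maxn N M)) ?leq_maxl // -(hM (maxn N M)) ?leq_maxr.
Qed.

Lemma lcvg_lim (u : nat -> laurent R) x : lcvg u x -> llim u = x.
Proof.
move=> ux; rewrite /llim; case: xgetP => [y _ uy|/(_ x)//].
exact: lcvg_unique uy ux.
Qed.

Lemma lcauchy_cvg (u : nat -> laurent R) :
  (forall n : int, exists N0 : nat, forall N M : nat,
     (N0 <= N)%N -> (N0 <= M)%N -> forall m : int, m <= n -> u N m = u M m) ->
  lcvg u (llim u).
Proof.
move=> /choice[N0 hN0].
have [b ub] := lcoef_bounded (u (N0 0)).
have bnd : exists b : int, forall n : int, n < b -> u (N0 n) n = 0.
  exists (Num.min b 0) => n; rewrite lt_min => /andP[nb n0].
  rewrite (hN0 n _ (maxn (N0 n) (N0 0))) ?leq_maxl //.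
  by rewrite (hN0 0 _ (N0 0)) ?leq_maxr ?ub // ltW.
suff: lcvg u (Laurent bnd) by move=> ux; rewrite (lcvg_lim ux).
move=> n; exists (N0 n) => N nN m mn /=.
rewrite (hN0 n _ (maxn (N0 n) (N0 m))) ?leq_maxl //.
by rewrite (hN0 m _ (N0 m)) ?leq_maxr.
Qed.

Definition lsum (a : nat -> laurent R) : laurent R :=
  llim (fun N => \sum_(n < N) a n).

Definition lprod (P : pred nat) (a : nat -> laurent R) : laurent R :=
  llim (fun N => \prod_(1 <= m < N | P m) a m).

End LaurentRing.

Notation "\lsum_ ( n '>=' 0 ) F" := (lsum (fun n => F))
  (at level 41, F at level 41, n at level 50,
   format "'[' \lsum_ ( n  '>='  0 ) '/  '  F ']'") : ring_scope.
Notation "\lprod_ ( m '>=' 1 | P ) F" := (lprod (fun m => P) (fun m => F))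
  (at level 36, F at level 36, m at level 50,
   format "'[' \lprod_ ( m  '>='  1  |  P ) '/  '  F ']'") : ring_scope.

Section ShelfSequence.
Variable R : comNzRingType.

Definition qvar : laurent R := lmono R 1.
Local Notation q := qvar.

Lemma qvar_unit : q \is a GRing.unit.
Proof. by apply/unitrPr; exists (lmono R (-1)); rewrite lmonoM subrr. Qed.

Definition Fprod : laurent R :=
  \lprod_(m >= 1 | m != 2 %[mod 4]) (1 - q ^+ m).

Definition Gprod (k i : nat) : laurent R :=
  \lprod_(m >= 1 | [&& m != 2 %[mod 4],
                       m != 0 %[mod 4 * k],
                       m != 2 * k + (2 * i - 1) %[mod 4 * k] &
                       m != 2 * k - (2 * i - 1) %[mod 4 * k]]%N)
    (1 - q ^+ m)^-1.

(* Only the values at l >= 1 are constrained. Every natural subtraction below *)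
(* is exact, by the bounds on i and j.                                        *)
Definition shelf_sequence (k : nat) (G : nat -> laurent R) : Prop :=
  (forall i : nat, (1 <= i <= k)%N -> G i = Gprod k i) /\
  (forall j i : nat, (1 <= j)%N -> (2 <= i <= k)%N ->
     G ((k - 1) * j + i)%N =
       (G ((k - 1) * (j - 1) + (k - i + 1))%N
        - G ((k - 1) * (j - 1) + (k - i + 2))%N) / q ^+ (2 * j * (i - 1))
       - q^-1 * G ((k - 1) * j + i - 1)%N).

(* shelf k j i is the i-th series of the j-th shelf; it only serves to show   *)
(* that the recursion of shelf_sequence is consistent.                        *)
Fixpoint shelf (k j : nat) : nat -> laurent R :=
  if j isn't j'.+1 then Gprod k else
  fix row (i : nat) : laurent R :=
    if i isn't i'.+1 then 0 else
    if i' is 0 then shelf k j' k else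
    (shelf k j' (k - i') - shelf k j' (k - i' + 1)%N) / q ^+ (2 * j * i')
    - q^-1 * row i'.

Lemma shelf_sequence_exists (k : nat) : (2 <= k)%N ->
  exists G, shelf_sequence k G.
Proof.
move=> k2.
pose G l := if (l <= k)%N then Gprod k l else
  shelf k ((l - 2) %/ (k - 1)) ((l - 2) %% (k - 1) + 2).
have G2 j i : (2 <= i <= k)%N -> G ((k - 1) * j + i)%N = shelf k j i.
  move=> ik; rewrite /G.
  have -> : ((k - 1) * j + i - 2 = j * (k - 1) + (i - 2))%N.
    by rewrite mulnC addnBA //; lia.
  rewrite divnMDl ?modnMDl ?divn_small ?modn_small; try lia.
  rewrite addn0 subnK; last lia.
  case: ifP => //; case: j => [|j] h; first by rewrite muln0 add0n.
  by nia.
have GE j i : (1 <= i <= k)%N -> G ((k - 1) * j + i)%N = shelf k j i.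
  move=> ik; have [i2|i1] := leqP 2 i; first by apply: G2; lia.
  have -> : i = 1%N by lia.
  case: j => [|j]; first by rewrite muln0 add0n /G ifT //; lia.
  have -> : ((k - 1) * j.+1 + 1 = (k - 1) * j + k)%N by lia.
  by rewrite G2 //; lia.
exists G; split=> [i ik|j i j1 ik].
  by rewrite -[i in LHS]add0n -(muln0 (k - 1)%N) GE.
have -> : ((k - 1) * j + i - 1 = (k - 1) * j + (i - 1))%N.
  by rewrite addnBA //; lia.
rewrite !GE; try lia.
case: j j1 => // j _; case: i ik => [|[|i]] // ik.
have -> : (j.+1 - 1 = j)%N by lia.
have -> : (k - i.+2 + 1 = k - i.+1)%N by lia.
have -> : (k - i.+2 + 2 = k - i.+1 + 1)%N by lia.
by have -> : (i.+2 - 1 = i.+1)%N by lia.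
Qed.

End ShelfSequence.

(* Main.v *)
Require Import Defs.
From mathcomp Require Import all_boot all_order all_algebra.
From mathcomp Require Import all_classical zify ring.

Import Order.TTheory GRing.Theory Num.Theory.
Local Open Scope ring_scope.

(* On the zeroth shelf, multiplying G_i by F leaves the product of 1 - q^m    *)
(* over m = 0, 2k + (2i-1), 2k - (2i-1) mod 4k, which the Jacobi triple       *)
(* product turns into the claimed series. For the higher shelves, the claimed *)
(* series satisfy the defining recursion and agree on the index shared by two *)
(* consecutive shelves: in both cases the n-th terms of the two sides differ  *)
(* by c(n+1) - c(n) with c(0) = 0 and c(n) = O(q^n), so the sums coincide.    *)

(** * q-adic valuation and limits *)

(** Multiplied by [Fprod R], the claim becomes F G_{(k-1)j+i} = [lsum (shelf_term R k j i)]. This is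
    [Fprod_shelf_sequence], an induction on the shelf j and, inside a shelf, on i. For j = 0, the
    residues 0, 2k+(2i-1), 2k-(2i-1) mod 4k are never 2 mod 4, so F cancels every denominator of
    G_i. The remaining product is a theta function with r + s = 4k ([Fprod_Gprod], from
    [triple_product_lcvg]). Pairing the indices n and -n-1 of its two-sided sum yields a factor 1 -
    q^(s(2n+1)), to which the bracket of the claim reduces after cancelling 1 + q^(2n+1)
    ([Fprod_Gprod_shelf0]). From shelf j to shelf j+1, [shelf_overlap] handles i = 1 and
    [shelf_recursion] handles i >= 2. Both use [shelf_shift]: replacing n by n+1 in the common
    prefix of shelf j, with a factor 1 - q^(2(n+1)), produces the prefix of shelf j+1 at n. Once a
    telescoping correction is chosen, a polynomial identity in powers of q is left. *)

Section QAdic.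
Set Implicit Arguments.
Unset Strict Implicit.
Variable R : comNzRingType.
Implicit Types (x y z c : laurent R) (u v a : nat -> laurent R) (n m N : nat).
Local Notation q := (qvar R).

(* x = O(q^n) *)
Definition qval n x := forall m : int, m < n%:Z -> x m = 0.

Lemma qvalW m n x : (m <= n)%N -> qval n x -> qval m x.
Proof. by move=> mn xn i im; apply: xn; lia. Qed.

Lemma qvalD n x y : qval n x -> qval n y -> qval n (x + y).
Proof. by move=> xn yn i im; rewrite lcoefD xn // yn // addr0. Qed.

Lemma qvalN n x : qval n x -> qval n (- x).
Proof. by move=> xn i im; rewrite lcoefN xn // oppr0. Qed.

Lemma qvalB n x y : qval n x -> qval n y -> qval n (x - y).
Proof. by move=> xn yn; apply: qvalD => //; apply: qvalN. Qed.

Lemma qvalM m n x y : qval m x -> qval n y -> qval (m + n) (x * y).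
Proof.
move=> xm yn i im; change ((x * y) i) with (lconv x y i).
rewrite (@lconvE _ x y m%:Z 0) ?big_ord0 // => l ml.
by apply: yn; lia.
Qed.

Lemma qvalMl n x y : qval 0 x -> qval n y -> qval n (x * y).
Proof. by move=> x0 yn; rewrite -[n]add0n; apply: qvalM. Qed.

Lemma qvalMr n x y : qval n x -> qval 0 y -> qval n (x * y).
Proof. by move=> xn y0; rewrite -[n]addn0; apply: qvalM. Qed.

Lemma qval1 : qval 0 1.
Proof. by move=> m m0; rewrite lcoef1 lt_eqF. Qed.

Lemma qvalX n x m : qval n x -> qval (n * m) (x ^+ m).
Proof.
move=> xn; elim: m => [|m IH]; first by rewrite muln0; exact: qval1.
by rewrite exprS mulnS; apply: qvalM.
Qed.

Lemma qval_q : qval 1 q.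
Proof. by move=> m m0; rewrite /= lt_eqF. Qed.

Lemma qval_qX m n : (n <= m)%N -> qval n (q ^+ m).
Proof.
by move=> nm; apply: (qvalW nm); rewrite -[X in qval X]mul1n;
  apply/qvalX/qval_q.
Qed.

Lemma qval_sign n : qval 0 ((-1) ^+ n).
Proof. exact: (@qvalX 0 _ n (@qvalN _ _ qval1)). Qed.

Lemma qval_sum n (I : Type) (r : seq I) (P : pred I) (F : I -> laurent R) :
  (forall i, P i -> qval n (F i)) -> qval n (\sum_(i <- r | P i) F i).
Proof. by move=> Fn; elim/big_ind: _ => //; exact: qvalD. Qed.

Lemma qval_prod (I : Type) (r : seq I) (P : pred I) (F : I -> laurent R) :
  (forall i, P i -> qval 0 (F i)) -> qval 0 (\prod_(i <- r | P i) F i).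
Proof. by move=> Fn; elim/big_ind: _ => //; [exact: qval1|exact: qvalMl]. Qed.

Lemma qval_prod_sub1 n (I : eqType) (r : seq I) (P : pred I)
    (F : I -> laurent R) :
  (forall i, i \in r -> P i -> qval n (F i - 1)) ->
  qval n (\prod_(i <- r | P i) F i - 1).
Proof.
move=> Fn; rewrite big_seq_cond.
elim/big_rec: _ => [|i x /andP[ir Pi] xn]; first by rewrite subrr.
have -> : F i * x - 1 = (F i - 1) * (x - 1) + ((F i - 1) + (x - 1)) by ring.
have Fin := Fn i ir Pi.
by apply: qvalD; [apply: qvalMr => //; apply: qvalW xn|exact: qvalD].
Qed.

Lemma qval_sub1 n x : qval n (x - 1) -> qval 0 x.
Proof.
by move=> xn; rewrite -(subrK 1 x); apply: qvalD qval1; apply: qvalW xn.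
Qed.

Lemma lcvgP u x : lcvg u x <->
  forall n, exists N0, forall N, (N0 <= N)%N -> qval n (u N - x).
Proof.
split=> [ux n|ux n].
  have [N0 hN0] := ux n%:Z; exists N0 => N N0N m mn.
  by rewrite lcoefD lcoefN hN0 ?subrr // ltW.
have [N0 hN0] := ux (absz n).+1; exists N0 => N N0N m mn.
by apply/eqP; rewrite -subr_eq0; apply/eqP; apply: (hN0 N N0N m); lia.
Qed.

Lemma lcvg_qval u x : (forall N, qval N (u N - x)) -> lcvg u x.
Proof.
by move=> ux; apply/lcvgP => n; exists n => N nN; apply: qvalW (ux N).
Qed.

Lemma lcvg_const x : lcvg (fun=> x) x.
Proof. by apply: lcvg_qval => N; rewrite subrr. Qed.

Lemma eq_lcvg u v x : u =1 v -> lcvg u x -> lcvg v x.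
Proof. by move=> /funext ->. Qed.

Lemma lcvgD u v x y : lcvg u x -> lcvg v y -> lcvg (fun N => u N + v N) (x + y).
Proof.
move=> /lcvgP ux /lcvgP vy; apply/lcvgP => n.
have [N0 h0] := ux n; have [N1 h1] := vy n.
exists (maxn N0 N1) => N; rewrite geq_max => /andP[N0N N1N].
by rewrite opprD addrACA; apply: qvalD; [exact: h0|exact: h1].
Qed.

Lemma lim_qval n u x : lcvg u x -> (forall N, qval n (u N)) -> qval n x.
Proof.
move=> /lcvgP/(_ n)[N0 h] un.
by rewrite -(subKr (u N0) x); apply: qvalB => //; apply: h.
Qed.

(** The order-0 bounds keep the errors small: multiplying an O(q^n) error by a series with a pole
    would lower its order. *)
Lemma lcvgM u v x y : (forall N, qval 0 (u N)) -> qval 0 y ->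
  lcvg u x -> lcvg v y -> lcvg (fun N => u N * v N) (x * y).
Proof.
move=> u0 y0 /lcvgP ux /lcvgP vy; apply/lcvgP => n.
have [N0 h0] := ux n; have [N1 h1] := vy n.
exists (maxn N0 N1) => N; rewrite geq_max => /andP[N0N N1N].
have -> : u N * v N - x * y = u N * (v N - y) + (u N - x) * y by ring.
by apply: qvalD; [apply: qvalMl (h1 N N1N)|apply: qvalMr (h0 N N0N) _].
Qed.

Lemma lcvgZ c u x : qval 0 c -> qval 0 x -> lcvg u x ->
  lcvg (fun N => c * u N) (c * x).
Proof. by move=> c0 x0; apply: lcvgM => //; exact: lcvg_const. Qed.

Lemma lcvg_sub u v x : lcvg u x -> (forall N, qval N (v N - u N)) -> lcvg v x.
Proof.
move=> ux vu.
have : lcvg (fun N => u N + (v N - u N)) (x + 0).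
  by apply: lcvgD ux _; apply: lcvg_qval => N; rewrite subr0.
by rewrite addr0; apply: eq_lcvg => N; rewrite addrC subrK.
Qed.

(** The bound O(q^n) on the n-th term makes the partial sums q-adically Cauchy; it is the
    convergence criterion for all series below. *)
Lemma lcvg_sum a : (forall n, qval n (a n)) ->
  lcvg (fun N => \sum_(n < N) a n) (\lsum_(n >= 0) a n).
Proof.
move=> an; apply: lcauchy_cvg => n; pose N0 := (absz n).+1; exists N0.
suff h N : (N0 <= N)%N ->
    qval N0 (\sum_(i < N) a i - \sum_(i < N0) a i).
  move=> N M N0N N0M m mn; apply/eqP; rewrite -subr_eq0; apply/eqP.
  have := qvalB (h N N0N) (h M N0M); rewrite opprB addrA subrK => /(_ m) <- //.
  by rewrite /N0; lia.
move=> N0N; rewrite -!(big_mkord xpredT a) (@big_cat_nat _ _ _ N0) //=.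
rewrite [X in X - _]addrC addrK.
rewrite big_nat; apply: qval_sum => i /andP[N0i _]; exact: qvalW (an i).
Qed.

Lemma qval_lsum a : (forall n, qval n (a n)) -> qval 0 (\lsum_(n >= 0) a n).
Proof.
move=> an; apply: (lim_qval (lcvg_sum an)) => N; apply: qval_sum => i _.
exact: qvalW (an i).
Qed.

Lemma lcvg_prod (P : pred nat) a : (forall n, qval n (a n - 1)) ->
  lcvg (fun N => \prod_(1 <= n < N | P n) a n) (lprod P a).
Proof.
move=> an; apply: lcauchy_cvg => n; pose N0 := (absz n).+1; exists N0.
pose p N := \prod_(1 <= n < N | P n) a n.
have p0 N : qval 0 (p N) by apply: qval_prod => i _; exact: qval_sub1 (an i).
suff h N : (N0 <= N)%N -> qval N0 (p N - p N0).
  move=> N M N0N N0M m mn; apply/eqP; rewrite -subr_eq0; apply/eqP.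
  have := qvalB (h N N0N) (h M N0M); rewrite opprB addrA subrK => /(_ m) <- //.
  by rewrite /N0; lia.
move=> N0N; rewrite /p (@big_cat_nat _ _ _ N0) //= -[X in _ - X]mulr1 -mulrBr.
apply: qvalMl (p0 N0) _; apply: qval_prod_sub1 => i; rewrite mem_index_iota.
by move=> /andP[N0i _] _; exact: qvalW (an i).
Qed.

(** Geometric series in 1 - x, which converges because 1 - x = O(q). *)
Lemma qval_unit x : qval 1 (x - 1) -> x * (\lsum_(n >= 0) (1 - x) ^+ n) = 1.
Proof.
move=> x1.
have y1 : qval 1 (1 - x) by rewrite -opprB; apply: qvalN.
have ys n : qval n ((1 - x) ^+ n).
  by rewrite -[X in qval X]mul1n; apply: qvalX.
apply: (@lcvg_unique _ (fun N => x * \sum_(n < N) (1 - x) ^+ n)).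
  apply: lcvgZ (lcvg_sum ys); last exact: qval_lsum.
  exact: qval_sub1 x1.
apply: lcvg_qval => N.
have -> : x * (\sum_(n < N) (1 - x) ^+ n) - 1 = - (1 - x) ^+ N.
  by rewrite -{1}(subKr 1 x) -opprB mulNr -subrX1; ring.
exact: qvalN.
Qed.

Lemma unit_sub1 x : qval 1 (x - 1) -> x \is a GRing.unit.
Proof. by move=> /qval_unit x1; apply/unitrPr; eexists; exact: x1. Qed.

Lemma qvalV x : qval 1 (x - 1) -> qval 0 x^-1.
Proof.
move=> x1; rewrite -[x^-1]mulr1 -(qval_unit x1) mulKr; last exact: unit_sub1.
apply: qval_lsum => n; rewrite -[X in qval X]mul1n; apply: qvalX.
by rewrite -opprB; apply: qvalN.
Qed.

Lemma qval_sub1V n x : (0 < n)%N -> qval n (x - 1) -> qval n (x^-1 - 1).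
Proof.
move=> n0 xn; have x1 : qval 1 (x - 1) by apply: qvalW xn.
have -> : x^-1 - 1 = x^-1 * - (x - 1).
  by rewrite opprB mulrBr mulr1 mulVr ?unit_sub1.
by apply: qvalMl; [exact: qvalV|exact: qvalN].
Qed.

End QAdic.

(** * Jacobi triple product *)

Lemma bin2S n : 'C(n.+1, 2) = ('C(n, 2) + n)%N.
Proof. by rewrite binS bin1. Qed.

Lemma bin2D m n : 'C(m + n, 2) = ('C(m, 2) + 'C(n, 2) + m * n)%N.
Proof.
elim: n => [|n IH]; first by rewrite bin0n !addn0 muln0 addn0.
by rewrite addnS !bin2S IH mulnS; lia.
Qed.

(** * Gaussian binomials and Rothe's formula *)

Section GaussianBinomial.
Set Implicit Arguments.
Unset Strict Implicit.
Variables (R : comNzRingType) (p : R).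

(** The Gaussian binomial, defined by the q-Pascal rule so as to make sense in any commutative ring,
    without division. *)
Fixpoint qbin (M s : nat) : R :=
  match M, s with
  | _, 0 => 1
  | 0, _.+1 => 0
  | M'.+1, s'.+1 => qbin M' s' + p ^+ s'.+1 * qbin M' s'.+1
  end.

Definition qpoch (n : nat) : R := \prod_(m < n) (1 - p ^+ m.+1).

Lemma qbin0 M : qbin M 0 = 1. Proof. by case: M. Qed.

Lemma qbinS M s : qbin M.+1 s.+1 = qbin M s + p ^+ s.+1 * qbin M s.+1.
Proof. by []. Qed.

Lemma qbin_small M s : (M < s)%N -> qbin M s = 0.
Proof.
elim: M s => [|M IH] [|s] //= Ms.
by rewrite !IH ?mulr0 ?addr0 //; lia.
Qed.

Lemma qpochS n : qpoch n.+1 = qpoch n * (1 - p ^+ n.+1).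
Proof. by rewrite /qpoch big_ord_recr. Qed.

(** The usual quotient formula with denominators cleared. The induction step is q-Pascal together
    with (1 - p^(s+1)) + p^(s+1)(1 - p^(t+1)) = 1 - p^(s+t+2). *)
Lemma qbin_qpoch s t : qbin (s + t) s * (qpoch s * qpoch t) = qpoch (s + t).
Proof.
have p0 : qpoch 0 = 1 by rewrite /qpoch big_ord0.
have [M] := ubnP (s + t); elim: M s t => // M IH [|s] [|t] h.
- by rewrite qbin0 p0 !mul1r.
- by rewrite add0n qbin0 p0 !mul1r.
- have := IH s 0 ltac:(lia).
  rewrite !addn0 p0 !mulr1 /= (@qbin_small s s.+1) // mulr0 addr0 => e.
  by rewrite qpochS mulrA e.
have := IH s t.+1 ltac:(lia); have := IH s.+1 t ltac:(lia).
rewrite !addSn !addnS !qpochS => e2 e1; rewrite qbinS.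
have -> : p ^+ (s + t).+2 = p ^+ s.+1 * p ^+ t.+1 by rewrite -exprD addSn addnS.
rewrite mulrDl.
transitivity ((1 - p ^+ s.+1) *
    (qbin (s + t).+1 s * (qpoch s * (qpoch t * (1 - p ^+ t.+1))))
  + p ^+ s.+1 * (1 - p ^+ t.+1) *
    (qbin (s + t).+1 s.+1 * (qpoch s * (1 - p ^+ s.+1) * qpoch t))).
  by ring.
by rewrite e1 e2; ring.
Qed.

(** The q-binomial theorem in homogeneous form. Splitting off the factor X - Y leaves the same
    product with Y replaced by Y p, and q-Pascal recombines the two resulting sums. *)
Lemma rothe (X Y : R) M :
  \prod_(m < M) (X - Y * p ^+ m) =
  \sum_(s < M.+1)
    qbin M s * ((-1) ^+ s * p ^+ 'C(s, 2) * Y ^+ s * X ^+ (M - s)).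
Proof.
elim: M Y => [|M IH] Y.
  by rewrite big_ord0 big_ord_recl big_ord0 /= !mulr1 addr0.
rewrite big_ord_recl expr0 mulr1.
under eq_bigr => m _ do rewrite /= /bump /= add1n exprS mulrA.
rewrite {}IH [RHS]big_ord_recl mulrBl addrC.
set S := \sum_(i < M.+1) _.
have -> : X * S = X ^+ M.+1 + \sum_(s < M.+1) p ^+ s.+1 * qbin M s.+1 *
    ((-1) ^+ s.+1 * p ^+ 'C(s.+1, 2) * Y ^+ s.+1 * X ^+ (M - s)).
  rewrite /S big_ord_recl mulrDr subn0 /= !mulr1 qbin0 !mul1r -exprS.
  congr (_ + _); rewrite [RHS]big_ord_recr /=.
  rewrite (@qbin_small M M.+1) // mulr0 mul0r addr0.
  rewrite mulr_sumr; apply: eq_bigr => s _; rewrite /= /bump /= add1n.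
  have -> : (M - s = (M - s.+1).+1)%N by have := ltn_ord s; lia.
  by rewrite exprMn [X ^+ _.+1]exprS; ring.
rewrite addrCA; congr (_ + _); first by rewrite bin0n subn0 /= !expr0 !mul1r.
rewrite addrC -mulNr mulr_sumr -big_split /=; apply: eq_bigr => s _.
rewrite /bump /= add1n subSS bin2S exprD exprMn !exprS; ring.
Qed.

End GaussianBinomial.
Arguments qbin {R} p M s : simpl never.

Lemma bin2_sqr n : ('C(n.+1, 2) + 'C(n, 2) = n * n)%N.
Proof.
by elim: n => [|n IH]; rewrite ?bin2S ?bin0n //; rewrite bin2S in IH; lia.
Qed.

(** * The triple product: finite form, then the limit *)

Section TripleProduct.
Set Implicit Arguments.
Unset Strict Implicit.

Lemma qbin_sym (S : comUnitRingType) (p : S) s t :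
  (forall m, 1 - p ^+ m.+1 \is a GRing.unit) ->
  qbin p (s + t) s = qbin p (s + t) t.
Proof.
move=> pu; have uP n : qpoch p n \is a GRing.unit by apply: rpred_prod => m _.
apply: (@mulIr _ (qpoch p s * qpoch p t)); first by rewrite unitrM !uP.
by rewrite qbin_qpoch [in RHS]addnC [X in _ * X]mulrC qbin_qpoch addnC.
Qed.

(** A finite form of the triple product, with p = ab. The 2N+2 terms of Rothe's expansion fold into
    N+1 pairs sharing a Gaussian binomial, by its symmetry; each pair contributes one factor 1 -
    b^(2n+1). *)
Lemma triple_product_finite (S : comUnitRingType) (a b : S) N :
  a \is a GRing.unit -> b \is a GRing.unit ->
  (forall m, 1 - (a * b) ^+ m.+1 \is a GRing.unit) ->
  (\prod_(m < N) (1 - a * (a * b) ^+ m)) *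
    (\prod_(m < N.+1) (1 - b * (a * b) ^+ m)) =
  \sum_(n < N.+1) qbin (a * b) (N.*2.+1) (N - n) *
    ((-1) ^+ n * a ^+ 'C(n.+1, 2) * b ^+ 'C(n, 2) * (1 - b ^+ n.*2.+1)).
Proof.
move=> au bu pu; set p := a * b in pu *.
(* Rothe's formula with X = p^N and Y = b: the N first factors are those      *)
(* involving a, and K is the common factor of the left-hand side.            *)
pose K := p ^+ (N * N.+1) * ((- b) ^+ N * p ^+ 'C(N, 2)).
have uK : K \is a GRing.unit by rewrite !unitrM !unitrX ?unitrN // unitrM au.
apply: (mulrI uK).
have -> : K * ((\prod_(m < N) (1 - a * p ^+ m)) *
    (\prod_(m < N.+1) (1 - b * p ^+ m))) =
  \prod_(m < N + N.+1) (p ^+ N - b * p ^+ m).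
  rewrite big_split_ord /= /K -mulrA [RHS]mulrC.
  have -> : \prod_(i < N) (p ^+ N - b * p ^+ i) =
      (- b) ^+ N * p ^+ 'C(N, 2) * \prod_(m < N) (1 - a * p ^+ m).
    have -> : (- b) ^+ N * p ^+ 'C(N, 2) = \prod_(m < N) (- b * p ^+ m).
      elim: (N) => [|M IH]; first by rewrite big_ord0 bin0n mulr1.
      by rewrite big_ord_recr -IH bin2S exprD exprS /=; ring.
    (* With the order of the a-factors reversed, p = ab gives p^N - b p^i = -b p^i (1 - a
       p^(N-1-i)). *)
    rewrite [X in _ = _ * X](reindex_inj rev_ord_inj) -big_split /=.
    apply: eq_bigr => i _.
    have -> : p ^+ N = p ^+ i * p ^+ (N - i.+1) * (a * b).
      by rewrite -exprD -exprSr; congr (p ^+ _); have := ltn_ord i; lia.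
    by ring.
  have -> : \prod_(i < N.+1) (p ^+ N - b * p ^+ (N + i)) =
      p ^+ (N * N.+1) * \prod_(m < N.+1) (1 - b * p ^+ m).
    rewrite exprM -[X in _ = _ ^+ X * _](card_ord N.+1).
    rewrite -prodr_const -big_split /=.
    by apply: eq_bigr => i _; rewrite exprD; ring.
  by ring.
(* Pair the indices s = N - n and s = N + 1 + n. *)
rewrite rothe addnS addnn mulr_sumr.
have -> : N.*2.+2 = (N.+1 + N.+1)%N by lia.
rewrite big_split_ord /= [X in X + _](reindex_inj rev_ord_inj) -big_split /=.
apply: eq_bigr => [[n /= nN] _]; rewrite [(N.+1 - n.+1)%N]subSS.
have [t Nt] : exists t, N = (t + n)%N by exists (N - n)%N; lia.
have -> : (N - n = t)%N by lia.
have -> : qbin p N.*2.+1 (N.+1 + n) = qbin p N.*2.+1 t.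
  have -> : N.*2.+1 = (N.+1 + n + t)%N by lia.
  exact: qbin_sym.
have -> : (N.*2.+1 - (N.+1 + n) = t)%N by lia.
have sq := bin2_sqr n.
have ab : (a * b) ^+ 'C(n.+1, 2) =
    a ^+ 'C(n.+1, 2) * (b ^+ 'C(n, 2) * b ^+ n).
  by rewrite -exprD -bin2S exprMn.
have eK x : K * x = (-1) ^+ N * b ^+ N * p ^+ (N * N.+1 + 'C(N, 2)) * x.
  by rewrite /K [(- b) ^+ N]exprNn exprD; ring.
(* The shared binomial is removed; the two members of the pair are then compared separately, each by
   its sign and its exponents of p and b. *)
rewrite -mulrDr mulrCA; congr (_ * _); rewrite mulrBr mulrBr; congr (_ + _).
  have -> : (N.*2.+1 - t = N + n.+1)%N by lia.
  rewrite mulr1 eK.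
  transitivity ((-1) ^+ N * (-1) ^+ n * b ^+ t *
      (p ^+ (N * N.+1 + 'C(N, 2)) * (a * b) ^+ 'C(n.+1, 2))); last first.
    have -> : b ^+ N = b ^+ t * b ^+ n by rewrite Nt exprD.
    rewrite ab.
    by ring.
  have -> : (-1) ^+ N * (-1) ^+ n = (-1) ^+ t :> S.
    by rewrite Nt exprD -mulrA -expr2 sqrr_sign mulr1.
  have -> : p ^+ (N * N.+1 + 'C(N, 2)) * (a * b) ^+ 'C(n.+1, 2) =
      p ^+ 'C(t, 2) * p ^+ N ^+ (N + n.+1).
    by rewrite -exprM -!exprD; congr (_ ^+ _); rewrite Nt bin2D; nia.
  by ring.
rewrite -mulrN eK.
transitivity (- ((-1) ^+ N * (-1) ^+ n) * b ^+ (N + n.+1) *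
    (p ^+ (N * N.+1 + 'C(N, 2)) * (a * b) ^+ 'C(n.+1, 2))); last first.
  rewrite ab.
  have -> : b ^+ n.*2.+1 = b ^+ n * b ^+ n.+1.
    by rewrite -exprD; congr (b ^+ _); lia.
  rewrite [b ^+ (N + _)]exprD.
  by ring.
have -> : - ((-1) ^+ N * (-1) ^+ n) = (-1) ^+ (N + n.+1) :> S.
  by rewrite -exprD addnS exprS mulN1r.
have -> : p ^+ (N * N.+1 + 'C(N, 2)) * (a * b) ^+ 'C(n.+1, 2) =
    p ^+ 'C(N + n.+1, 2) * p ^+ N ^+ t.
  by rewrite -exprM -!exprD; congr (_ ^+ _); rewrite bin2D Nt; nia.
have -> : (N.+1 + n = N + n.+1)%N by lia.
by ring.
Qed.

Variable R : comNzRingType.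
Local Notation q := (qvar R).

Lemma qX_unit n : q ^+ n \is a GRing.unit.
Proof. exact: unitrX (qvar_unit R). Qed.

Lemma sub1qX_sub1 n m : (n <= m)%N -> qval n (1 - q ^+ m - 1).
Proof. by move=> nm; rewrite addrAC subrr sub0r; apply/qvalN/qval_qX. Qed.

Lemma add1qX_sub1 n m : (n <= m)%N -> qval n (1 + q ^+ m - 1).
Proof. by move=> nm; rewrite addrC addKr; apply/qval_qX. Qed.

Lemma qval0_sub1qX m : qval 0 (1 - q ^+ m).
Proof. exact: (qval_sub1 (@sub1qX_sub1 0 m isT)). Qed.

Lemma qval0_add1qX m : qval 0 (1 + q ^+ m).
Proof. exact: (qval_sub1 (@add1qX_sub1 0 m isT)). Qed.

Lemma sub1qX_unit n : (0 < n)%N -> 1 - q ^+ n \is a GRing.unit.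
Proof. by move=> n0; apply: unit_sub1; apply: sub1qX_sub1. Qed.

Lemma qpoch_sub1 e s : (0 < e)%N -> qval 1 (qpoch (q ^+ e) s - 1).
Proof.
move=> e0; apply: qval_prod_sub1 => m _ _.
by rewrite -exprM; apply: sub1qX_sub1; lia.
Qed.

Lemma qpoch_div e s t : (0 < e)%N -> (s <= t)%N ->
  qval s.+1 (qpoch (q ^+ e) t / qpoch (q ^+ e) s - 1).
Proof.
move=> e0 st.
have us : qpoch (q ^+ e) s \is a GRing.unit by apply/unit_sub1/qpoch_sub1.
have -> : qpoch (q ^+ e) t =
    qpoch (q ^+ e) s * \prod_(s <= m < t) (1 - q ^+ e ^+ m.+1).
  rewrite /qpoch -!(big_mkord xpredT (fun m => 1 - q ^+ e ^+ m.+1)).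
  by rewrite -big_cat_nat.
rewrite mulrAC divrr // mul1r; apply: qval_prod_sub1 => m.
rewrite mem_index_iota => /andP[sm _] _; rewrite -exprM.
by apply: sub1qX_sub1; nia.
Qed.

(** The product is a quotient (p;p)_N / (p;p)_(N-n) times a quotient (p;p)_(2N+1) / (p;p)_(N+n+1),
    and only factors of high degree survive in each. *)
Lemma qbin_sub1 e N n : (0 < e)%N -> (n <= N)%N ->
  qval (N - n).+1
    (qpoch (q ^+ e) N * qbin (q ^+ e) (N.*2.+1) (N - n) - 1).
Proof.
move=> e0 nN; set P := qpoch (q ^+ e).
have uP s : P s \is a GRing.unit by apply/unit_sub1/qpoch_sub1.
have -> : P N * qbin (q ^+ e) (N.*2.+1) (N - n) =
    (P N / P (N - n)%N) * (P N.*2.+1 / P (N + n).+1).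
  have -> : N.*2.+1 = (N - n + (N + n).+1)%N by lia.
  have := @qbin_qpoch _ (q ^+ e) (N - n) (N + n).+1; rewrite -/P => <-.
  set x := qbin _ _ _; set s := (N - n)%N; set t := (N + n).+1.
  have -> : x * (P s * P t) / P t = P s * x by rewrite mulrA mulrK // mulrC.
  by rewrite mulrA divrK.
set x := _ / _; set y := _ / _.
have -> : x * y - 1 = (x - 1) * y + (y - 1) by ring.
have y1 : qval (N - n).+1 (y - 1).
  by apply: qvalW (qpoch_div e0 _); lia.
apply: qvalD => //; apply: qvalMr; last exact: qval_sub1 y1.
by apply: qpoch_div => //; lia.
Qed.

(** The factor (p;p)_N, p = q^(r+s), makes the n-th coefficient of the finite form 1 + O(q^(N-n+1)).
    As the n-th term is O(q^n), the error is O(q^(N+1)) uniformly in n, and the limit may be taken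
    term by term. *)
Lemma triple_product_lcvg (r s : nat) : (0 < r)%N -> (0 < s)%N ->
  lcvg (fun N => (\prod_(m < N) (1 - q ^+ (r + (r + s) * m))) *
     (\prod_(m < N.+1) (1 - q ^+ (s + (r + s) * m))) *
     \prod_(m < N) (1 - q ^+ ((r + s) * m.+1)))
    (\lsum_(n >= 0) ((-1) ^+ n * q ^+ (r * 'C(n.+1, 2) + s * 'C(n, 2)) *
       (1 - q ^+ (s * n.*2.+1)))).
Proof.
move=> r0 s0.
have vc n : qval n ((-1) ^+ n * q ^+ (r * 'C(n.+1, 2) + s * 'C(n, 2)) *
    (1 - q ^+ (s * n.*2.+1))).
  apply: qvalMr; last exact: qval0_sub1qX.
  by apply: qvalMl (@qval_sign _ n) _; apply: qval_qX; rewrite bin2S; nia.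
apply: (lcvg_sub (lcvg_sum vc)) => N.
have -> : \prod_(m < N) (1 - q ^+ (r + (r + s) * m)) =
    \prod_(m < N) (1 - q ^+ r * (q ^+ r * q ^+ s) ^+ m).
  by apply: eq_bigr => m _; rewrite -exprD -exprM -exprD.
have -> : \prod_(m < N.+1) (1 - q ^+ (s + (r + s) * m)) =
    \prod_(m < N.+1) (1 - q ^+ s * (q ^+ r * q ^+ s) ^+ m).
  by apply: eq_bigr => m _; rewrite -exprD -exprM -exprD.
rewrite triple_product_finite ?qX_unit //; last first.
  by move=> m; rewrite -exprD -exprM; apply: sub1qX_unit; lia.
have -> : \prod_(m < N) (1 - q ^+ ((r + s) * m.+1)) = qpoch (q ^+ (r + s)) N.
  by apply: eq_bigr => m _; rewrite exprM.
have e0 : (0 < r + s)%N by lia.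
rewrite -exprD mulr_suml big_ord_recr /= addrAC -sumrB.
have w n : (n <= N)%N -> qval (N - n).+1
    (qbin (q ^+ (r + s)) (N.*2.+1) (N - n) * qpoch (q ^+ (r + s)) N - 1).
  by move=> nN; rewrite mulrC; exact: qbin_sub1.
have cE n x y : x * ((-1) ^+ n * q ^+ r ^+ 'C(n.+1, 2) * q ^+ s ^+ 'C(n, 2) *
    (1 - q ^+ s ^+ n.*2.+1)) * y = x * y * ((-1) ^+ n *
    q ^+ (r * 'C(n.+1, 2) + s * 'C(n, 2)) * (1 - q ^+ (s * n.*2.+1))).
  by rewrite -!exprM [q ^+ (_ + _)]exprD; ring.
(* The finite form has one term more than the N-th partial sum; that term, n = N, is itself
   O(q^N). *)
apply: qvalD; last first.
  rewrite cE; apply: qvalMl (vc N); exact: qval_sub1 (w N (leqnn N)).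
apply: qval_sum => [[n /= nN]] _; rewrite cE -[X in _ - X]mul1r -mulrBl.
by apply: qvalW (qvalM (w n (ltnW nN)) (vc n)); lia.
Qed.

End TripleProduct.

(** * The zeroth shelf *)

Section Products.
Set Implicit Arguments.
Unset Strict Implicit.

(** Each block cN+1, ..., cN+c contains exactly one index of each residue; the residue 0 is attained
    at its end, whence [c * t.+1]. *)
Lemma prod_residues (S : comNzRingType) (f : nat -> S) (c r s N : nat) :
  (0 < s < r)%N -> (r < c)%N ->
  \prod_(1 <= m < (c * N).+1 | [|| m %% c == 0, m %% c == r | m %% c == s]%N)
    f m =
  \prod_(t < N) (f (r + c * t)%N * f (s + c * t)%N * f (c * t.+1)%N).
Proof.
move=> /andP[s0 sr] rc; elim: N => [|N IH].
  by rewrite muln0 big_ord0 big_geq.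
rewrite big_ord_recr -IH /= (@big_cat_nat _ _ _ (c * N).+1) /=; try lia.
congr (_ * _).
rewrite big_nat_cond (eq_bigl (fun m =>
    ((c * N).+1 <= m < (c * N.+1).+1)%N &&
    [|| m == c * N.+1, m == r + c * N | m == s + c * N]%N)); last first.
  move=> m; case: (boolP (_ <= m < _)%N) => //= /andP[m1 m2].
  have [u mu] : exists u, (m = N * c + u)%N by exists (m - c * N)%N; lia.
  rewrite mu modnMDl mulnC; have [uc|uc] := ltnP u c.
    by rewrite modn_small //; lia.
  have -> : u = c by lia.
  by rewrite modnn; lia.
rewrite -big_nat_cond (bigID (fun m => m == c * N.+1)%N) /=.
rewrite [X in _ * X](bigID (fun m => m == r + c * N)%N) /=.
rewrite (eq_bigl (fun m => m == c * N.+1)%N); last by move=> m; lia.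
rewrite [X in _ * (X * _)](eq_bigl (fun m => m == r + c * N)%N);
  last by move=> m; lia.
rewrite [X in _ * (_ * X)](eq_bigl (fun m => m == s + c * N)%N);
  last by move=> m; lia.
rewrite !big_nat1_eq !ifT; [|lia..].
by rewrite mulrC.
Qed.

Lemma lcvg_comp (R : comNzRingType) (u : nat -> laurent R) x (f : nat -> nat) :
  (forall N, (N <= f N)%N) -> lcvg u x -> lcvg (u \o f) x.
Proof.
move=> fN ux n; have [N0 h] := ux n; exists N0 => N N0N m mn.
by apply: h => //; apply: leq_trans (fN N).
Qed.

Variable R : comNzRingType.
Local Notation q := (qvar R).

Lemma Fprod_lcvg :
  lcvg (fun N => \prod_(1 <= m < N | m != 2 %[mod 4]) (1 - q ^+ m)) (Fprod R).
Proof. by apply: lcvg_prod => m; apply: sub1qX_sub1. Qed.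

Lemma Fprod_unit : Fprod R \is a GRing.unit.
Proof.
apply: unit_sub1; have f N : qval 1
    (\prod_(1 <= m < N | m != 2 %[mod 4]) (1 - q ^+ m) - 1).
  apply: qval_prod_sub1 => m; rewrite mem_index_iota => /andP[m1 _] _.
  exact: sub1qX_sub1.
apply: (@lim_qval _ _ _ _ _ f); apply: lcvgD Fprod_lcvg _; exact: lcvg_const.
Qed.

Lemma Fprod_Gprod (k i : nat) : (1 <= i <= k)%N ->
  Fprod R * Gprod R k i = \lsum_(n >= 0) ((-1) ^+ n *
    q ^+ ((2 * k + (2 * i - 1)) * 'C(n.+1, 2) +
          (2 * k - (2 * i - 1)) * 'C(n, 2)) *
    (1 - q ^+ ((2 * k - (2 * i - 1)) * n.*2.+1))).
Proof.
move=> ik; set r := (2 * k + _)%N; set s := (2 * k - _)%N.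
pose PG m := [&& m != 2 %[mod 4], m != 0 %[mod 4 * k],
  m != r %[mod 4 * k] & m != s %[mod 4 * k]]%N.
have Glim : lcvg (fun N => \prod_(1 <= m < N | PG m) (1 - q ^+ m)^-1)
    (Gprod R k i).
  apply: lcvg_prod => -[|m].
    (* At m = 0 the inverse is the default 0^-1 = 0. The products start at m = 1, and only O(q^0) is
       demanded here. *)
    by rewrite expr0 subrr invr0 sub0r; exact/qvalN/qval1.
  by apply: qval_sub1V => //; apply: sub1qX_sub1.
have p0 m : qval 0 (1 - q ^+ m) := qval0_sub1qX R m.
have G0 : qval 0 (Gprod R k i).
  apply: (lim_qval Glim) => N; rewrite big_seq_cond.
  apply: qval_prod => m /andP[]; rewrite mem_index_iota => /andP[m1 _] _.
  by apply: qvalV; apply: sub1qX_sub1.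
have rs : (r + s = 4 * k)%N by rewrite /r /s; lia.
have FG N : \prod_(1 <= m < N | m != 2 %[mod 4]) (1 - q ^+ m) *
    \prod_(1 <= m < N | PG m) (1 - q ^+ m)^-1 =
  \prod_(1 <= m < N | [|| m %% (4 * k) == 0, m %% (4 * k) == r |
    m %% (4 * k) == s]%N) (1 - q ^+ m).
  rewrite (bigID PG) /= (eq_bigl PG); last first.
    by move=> m; rewrite /PG; case: (_ != _ %[mod 4]).
  rewrite mulrAC -big_split /= big_nat_cond big1 ?mul1r; last first.
    by move=> m /andP[/andP[m1 _] _]; rewrite divrr ?sub1qX_unit.
  (* Every condition is expressed through m mod 4k. Since r and s are odd, none of 0, r, s is 2 mod
     4. *)
  apply: eq_bigl => m.
  have -> : ((m %% 4 != 2 %% 4) = ((m %% (4 * k)) %% 4 != 2))%N.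
    by rewrite modn_dvdm // dvdn_mulr.
  have -> : PG m = [&& m %% (4 * k) %% 4 != 2, m %% (4 * k) != 0,
      m %% (4 * k) != r & m %% (4 * k) != s]%N.
    rewrite /PG mod0n (@modn_small r) ?(@modn_small s) ?modn_dvdm ?dvdn_mulr //.
      by rewrite /s; lia.
    by rewrite /r; lia.
  by rewrite /r /s; lia.
have s0 : (0 < s < r)%N by rewrite /r /s; lia.
have rc : (r < 4 * k)%N by rewrite /r; lia.
have vN N : (N <= (4 * k * N).+1)%N by nia.
apply: (@lcvg_unique _ (fun N => \prod_(t < N) ((1 - q ^+ (r + 4 * k * t)) *
  (1 - q ^+ (s + 4 * k * t)) * (1 - q ^+ (4 * k * t.+1))))).
  have F0 N : qval 0 (\prod_(1 <= m < N | m != 2 %[mod 4]) (1 - q ^+ m)).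
    by apply: qval_prod => m _; exact: p0.
  have := lcvg_comp vN (lcvgM F0 G0 Fprod_lcvg Glim); apply: eq_lcvg => N.
  by rewrite /= FG prod_residues.
have := @triple_product_lcvg R r s ltac:(lia) ltac:(lia); rewrite rs => h.
(* The triple product carries one extra factor 1 - q^(s+4kN); dropping it changes the product by
   O(q^N). *)
apply: (lcvg_sub h) => N; rewrite big_ord_recr /= !big_split /=.
set X := \prod_(t < N) _; set Y := \prod_(t < N) _; set Z := \prod_(t < N) _.
have -> : X * Y * Z - X * (Y * (1 - q ^+ (s + 4 * k * N))) * Z =
   X * Y * Z * q ^+ (s + 4 * k * N) by ring.
apply: qvalMl; last by apply: qval_qX; nia.
by apply: qvalMl; [apply: qvalMl|]; apply: qval_prod => m _; exact: p0.
Qed.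

End Products.

(** * The recursion between shelves *)

Section Sums.
Set Implicit Arguments.
Unset Strict Implicit.
Variable R : comNzRingType.
Implicit Types (a b c : nat -> laurent R).

Lemma lsumD a b : (forall n, qval n (a n)) -> (forall n, qval n (b n)) ->
  lsum (fun n => a n + b n) = lsum a + lsum b.
Proof.
move=> an bn; apply: lcvg_lim.
by apply: eq_lcvg (lcvgD (lcvg_sum an) (lcvg_sum bn)) => N; rewrite big_split.
Qed.

Lemma lsumZ x a : qval 0 x -> (forall n, qval n (a n)) ->
  lsum (fun n => x * a n) = x * lsum a.
Proof.
move=> x0 an; apply: lcvg_lim.
apply: eq_lcvg (lcvgZ x0 (qval_lsum an) (lcvg_sum an)) => N.
by rewrite mulr_sumr.
Qed.

Lemma lsumB a b : (forall n, qval n (a n)) -> (forall n, qval n (b n)) ->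
  lsum (fun n => a n - b n) = lsum a - lsum b.
Proof.
move=> an bn; have Nb n : qval n (- b n) by exact: qvalN.
apply/eqP; rewrite eq_sym subr_eq -lsumD //; last first.
  by move=> n; apply: qvalB.
by apply/eqP; congr lsum; apply/funext => n; rewrite subrK.
Qed.

Lemma lsum_telescope a b c : (forall n, qval n (b n)) ->
  (forall n, qval n (c n)) -> c 0 = 0 ->
  (forall n, a n = b n + (c n.+1 - c n)) -> lsum a = lsum b.
Proof.
move=> bn cn c0 abc; apply: lcvg_lim; apply: (lcvg_sub (lcvg_sum bn)) => N.
rewrite (eq_bigr _ (fun i _ => abc (nat_of_ord i))) big_split /=.
rewrite [X in X - _]addrC addrK.
rewrite -(big_mkord xpredT (fun i => c i.+1 - c i)) telescope_sumr // c0 subr0.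
exact: cn.
Qed.

End Sums.

(** * Summands of the claimed series and their telescoping identities *)

Section ShelfTerms.
Set Implicit Arguments.
Unset Strict Implicit.
Variables (R : comNzRingType).
Local Notation q := (qvar R).

Definition shelf_num j n := \prod_(1 <= t < j.+1) (1 - q ^+ (2 * (n + t))).
Definition shelf_den j n := \prod_(0 <= t < j.+1) (1 + q ^+ (2 * (n + t) + 1)).

Definition shelf_term k j i n :=
  (-1) ^+ n * q ^+ (4 * k * 'C(n, 2) + (2 * k * (j + 1) + 2 * i - 1) * n)
    * shelf_num j n / shelf_den j n
  * (1 - q ^+ (2 * (k - i + 1) * (2 * n + j + 1))
     + q ^+ (2 * (n + j) + 1) * (1 - q ^+ (2 * (k - i) * (2 * n + j + 1)))).

Lemma shelf_numSr j n :
  shelf_num j.+1 n = shelf_num j n * (1 - q ^+ (2 * (n + j.+1))).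
Proof. by rewrite /shelf_num big_nat_recr. Qed.

Lemma shelf_numSl j n :
  shelf_num j.+1 n = (1 - q ^+ (2 * n.+1)) * shelf_num j n.+1.
Proof.
rewrite /shelf_num big_nat_recl // addn1; congr (_ * _).
by apply: eq_bigr => t _; rewrite addSnnS.
Qed.

Lemma shelf_denSr j n :
  shelf_den j.+1 n = shelf_den j n * (1 + q ^+ (2 * (n + j.+1) + 1)).
Proof. by rewrite /shelf_den big_nat_recr. Qed.

Lemma shelf_denSl j n :
  shelf_den j.+1 n = (1 + q ^+ (2 * n + 1)) * shelf_den j n.+1.
Proof.
rewrite /shelf_den big_nat_recl // addn0; congr (_ * _).
by apply: eq_bigr => t _; rewrite addSnnS.
Qed.

Lemma shelf_den_sub1 j n : qval 1 (shelf_den j n - 1).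
Proof. by apply: qval_prod_sub1 => t _ _; apply: add1qX_sub1; lia. Qed.

Lemma shelf_den_unit j n : shelf_den j n \is a GRing.unit.
Proof. exact/unit_sub1/shelf_den_sub1. Qed.

(** With [shelf_denVl], this puts the terms at n and n+1 of shelf j over the common denominator
    [shelf_den j.+1 n]. *)
Lemma shelf_denVr j n : (shelf_den j n)^-1 =
  (shelf_den j.+1 n)^-1 * (1 + q ^+ (2 * (n + j.+1) + 1)).
Proof.
rewrite shelf_denSr invrM ?shelf_den_unit //; last first.
  by apply/unit_sub1/add1qX_sub1; lia.
by rewrite mulrAC mulVr ?mul1r //; apply/unit_sub1/add1qX_sub1; lia.
Qed.

Lemma shelf_denVl j n : (shelf_den j n.+1)^-1 =
  (shelf_den j.+1 n)^-1 * (1 + q ^+ (2 * n + 1)).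
Proof.
rewrite shelf_denSl invrM ?shelf_den_unit //; last first.
  by apply/unit_sub1/add1qX_sub1; lia.
by rewrite -mulrA mulVr ?mulr1 //; apply/unit_sub1/add1qX_sub1; lia.
Qed.

Lemma qval0_shelf_num j n : qval 0 (shelf_num j n).
Proof. by apply: qval_prod => t _; exact: qval0_sub1qX. Qed.

Lemma shelf_prefix_qval j m n : (n <= m)%N ->
  qval n ((-1) ^+ n * q ^+ m * shelf_num j n / shelf_den j n).
Proof.
move=> nm; apply: qvalMr; last exact/qvalV/shelf_den_sub1.
apply: qvalMr; last exact: qval0_shelf_num.
by apply: qvalMl (@qval_sign _ n) _; exact: qval_qX.
Qed.

Lemma shelf_term_qval k j i n : (0 < i)%N -> qval n (shelf_term k j i n).
Proof.
move=> i0; apply: qvalMr; first by apply: shelf_prefix_qval; nia.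
apply: qvalD; first exact: qval0_sub1qX.
by apply: qvalMl; [exact: qval_qX|exact: qval0_sub1qX].
Qed.

Ltac qmono := rewrite -?exprM -?exprD; congr (_ ^+ _); nia.

Lemma shelf_shift j m n :
  (-1) ^+ n.+1 * q ^+ m * shelf_num j n.+1 / shelf_den j n.+1 *
    (1 - q ^+ (2 * n.+1)) =
  - ((-1) ^+ n * q ^+ m * shelf_num j.+1 n / shelf_den j.+1 n *
     (1 + q ^+ (2 * n + 1))).
Proof. by rewrite shelf_numSl shelf_denVl exprS; ring. Qed.

Lemma shelf_overlap k j : (0 < k)%N ->
  lsum (shelf_term k j.+1 1) = lsum (shelf_term k j k).
Proof.
case: k => // k _.
pose pre n := (-1) ^+ n *
  q ^+ (4 * k.+1 * 'C(n, 2) + (2 * k.+1 * (j + 1) + (2 * k + 1)) * n)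
  * shelf_num j n / shelf_den j n.
(* The term of shelf j has bracket 1 - q^(4n+2j+2). Subtracting c(n) leaves q^(2n)(1 -
   q^(2(n+j+1))), whose last factor completes [shelf_num j.+1 n]; c(n+1) supplies the rest through
   [shelf_shift]. *)
pose c n := pre n * (1 - q ^+ (2 * n)).
apply: (@lsum_telescope _ _ _ c) => [n|n||n].
- exact: shelf_term_qval.
- apply: qvalMr; last exact: qval0_sub1qX.
  by apply: shelf_prefix_qval; nia.
- by rewrite /c muln0 expr0 subrr mulr0.
rewrite /c /pre shelf_shift /shelf_term (shelf_denVr j n) shelf_numSr.
set W := (shelf_den _ _)^-1; set M := shelf_num j n.
rewrite [(k.+1 - 1)%N]subSS subn0 subnn muln0 mul0n expr0 subrr mulr0 addr0.
set x := q ^+ n; set y := q ^+ j; set P := q ^+ (2 * k * (2 * n + j + 2)).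
set B := q ^+ (4 * k.+1 * 'C(n, 2) + (2 * k.+1 * (j + 1) + (2 * k + 1)) * n).
have -> : q ^+ (4 * k.+1 * 'C(n, 2) +
    (2 * k.+1 * (j + 1) + 2 * k.+1 - 1) * n) = B.
  by congr (_ ^+ _); nia.
have -> : q ^+ (4 * k.+1 * 'C(n, 2) + (2 * k.+1 * (j.+1 + 1) + 2 * 1 - 1) * n) =
    B * x ^+ 2 by qmono.
have -> : q ^+ (4 * k.+1 * 'C(n.+1, 2) +
      (2 * k.+1 * (j + 1) + (2 * k + 1)) * n.+1) =
    B * P * x ^+ 4 * y ^+ 2 * q ^+ 3 by rewrite bin2S; qmono.
have -> : q ^+ (2 * (n + j.+1)) = x ^+ 2 * y ^+ 2 * q ^+ 2 by qmono.
have -> : q ^+ (2 * (n + j.+1) + 1) = x ^+ 2 * y ^+ 2 * q ^+ 3 by qmono.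
have -> : q ^+ (2 * (k + 1) * (2 * n + j.+1 + 1)) =
  P * x ^+ 4 * y ^+ 2 * q ^+ 4 by qmono.
have -> : q ^+ (2 * k * (2 * n + j.+1 + 1)) = P by qmono.
have -> : q ^+ (2 * (0 + 1) * (2 * n + j + 1)) =
  x ^+ 4 * y ^+ 2 * q ^+ 2 by qmono.
have -> : q ^+ (2 * n + 1) = x ^+ 2 * q ^+ 1 by qmono.
have -> : q ^+ (2 * n) = x ^+ 2 by qmono.
by ring.
Qed.

(** The defining recursion at i = e+1 on shelf j+1, multiplied by q^(2(j+1)e+1) so that only power
    series occur and [lsumZ] applies. *)
Lemma shelf_recursion k j e : (0 < e < k)%N ->
  q ^+ (2 * j.+1 * e) *
    (q * lsum (shelf_term k j.+1 e.+1) + lsum (shelf_term k j.+1 e)) =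
  q * (lsum (shelf_term k j (k - e)) - lsum (shelf_term k j (k - e).+1)).
Proof.
case: e => // e /andP[_ ek].
have [f kE] : exists f, k = (e.+1 + f.+1)%N by exists (k - e.+1).-1; lia.
have -> : (k - e.+1 = f.+1)%N by lia.
pose pre n := (-1) ^+ n *
  q ^+ (4 * k * 'C(n, 2) + (2 * k * (j + 1) + (2 * f + 1)) * n)
  * shelf_num j n / shelf_den j n.
(* With e lowered by one, c(n) is the part of the right-hand summand free of the power
   q^(2e(2n+j+1)). What remains has the factor 1 - q^(2(n+j+1)), which completes
   [shelf_num j.+1 n]. *)
pose c n := q * (pre n * (1 + q ^+ (2 * (n + j) + 1)) * (1 - q ^+ (2 * n))).
have q0 : qval 0 q by rewrite -[q]expr1; apply: qval_qX.
pose t1 := shelf_term k j.+1 e.+2; pose t2 := shelf_term k j.+1 e.+1.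
pose t3 := shelf_term k j f.+1; pose t4 := shelf_term k j f.+2.
have v1 n : qval n (t1 n) by exact: shelf_term_qval.
have v2 n : qval n (t2 n) by exact: shelf_term_qval.
have v3 n : qval n (t3 n) by exact: shelf_term_qval.
have v4 n : qval n (t4 n) by exact: shelf_term_qval.
have v1q n : qval n (q * t1 n) by exact: qvalMl.
have v12 n : qval n (q * t1 n + t2 n) by exact: qvalD.
have v34 n : qval n (t3 n - t4 n) by exact: qvalB.
have -> : q * lsum t1 + lsum t2 = lsum (fun n => q * t1 n + t2 n).
  by rewrite lsumD // lsumZ.
rewrite -lsumB //.
rewrite -!lsumZ //; last exact: qval_qX.
apply: (@lsum_telescope _ _ _ c) => [n|n||n].
- exact: qvalMl.
- apply: qvalMl => //; apply: qvalMr; last exact: qval0_sub1qX.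
  apply: qvalMr; last exact: qval0_add1qX.
  by apply: shelf_prefix_qval; nia.
- by rewrite /c muln0 expr0 subrr !mulr0.
have -> : c n.+1 = q * (1 + q ^+ (2 * (n.+1 + j) + 1)) *
  (pre n.+1 * (1 - q ^+ (2 * n.+1))).
  by rewrite /c; ring.
rewrite /c /pre shelf_shift.
rewrite /t1 /t2 /t3 /t4 /shelf_term (shelf_denVr j n) shelf_numSr.
set W := (shelf_den _ _)^-1; set M := shelf_num j n.
have -> : (k - e.+2 + 1 = f.+1)%N by lia.
have -> : (k - e.+2 = f)%N by lia.
have -> : (k - e.+1 + 1 = f.+2)%N by lia.
have -> : (k - e.+1 = f.+1)%N by lia.
have -> : (k - f.+1 + 1 = e.+2)%N by lia.
have -> : (k - f.+1 = e.+1)%N by lia.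
have -> : (k - f.+2 + 1 = e.+1)%N by lia.
have -> : (k - f.+2 = e)%N by lia.
set x := q ^+ n; set y := q ^+ j; set P := q ^+ (2 * f * (2 * n + j + 2)).
set Q1 := q ^+ (4 * e * n); set Q2 := q ^+ (2 * e * j.+1).
set B := q ^+ (4 * k * 'C(n, 2) + (2 * k * (j + 1) + (2 * f + 1)) * n).
have -> : q ^+ (2 * j.+1 * e.+1) = Q2 * y ^+ 2 * q ^+ 2 by qmono.
have -> : q ^+ (4 * k * 'C(n, 2) + (2 * k * (j.+1 + 1) + 2 * e.+2 - 1) * n) =
  B * Q1 * x ^+ 6 by qmono.
have -> : q ^+ (4 * k * 'C(n, 2) + (2 * k * (j.+1 + 1) + 2 * e.+1 - 1) * n) =
  B * Q1 * x ^+ 4 by qmono.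
have -> : q ^+ (4 * k * 'C(n, 2) + (2 * k * (j + 1) + 2 * f.+1 - 1) * n) = B.
  by congr (_ ^+ _); nia.
have -> : q ^+ (4 * k * 'C(n, 2) + (2 * k * (j + 1) + 2 * f.+2 - 1) * n) =
  B * x ^+ 2 by qmono.
have -> : q ^+ (4 * k * 'C(n.+1, 2) +
      (2 * k * (j + 1) + (2 * f + 1)) * n.+1) =
    B * Q1 * Q2 * P * x ^+ 8 * y ^+ 4 * q ^+ 5 by rewrite bin2S; qmono.
have -> : q ^+ (2 * (n + j.+1)) = x ^+ 2 * y ^+ 2 * q ^+ 2 by qmono.
have -> : q ^+ (2 * (n + j.+1) + 1) = x ^+ 2 * y ^+ 2 * q ^+ 3 by qmono.
have -> : q ^+ (2 * (n.+1 + j) + 1) = x ^+ 2 * y ^+ 2 * q ^+ 3 by qmono.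
have -> : q ^+ (2 * (n + j) + 1) = x ^+ 2 * y ^+ 2 * q ^+ 1 by qmono.
have -> : q ^+ (2 * f.+2 * (2 * n + j.+1 + 1)) =
  P * x ^+ 8 * y ^+ 4 * q ^+ 8 by qmono.
have -> : q ^+ (2 * f.+1 * (2 * n + j.+1 + 1)) =
  P * x ^+ 4 * y ^+ 2 * q ^+ 4 by qmono.
have -> : q ^+ (2 * f * (2 * n + j.+1 + 1)) = P by qmono.
have -> : q ^+ (2 * e.+2 * (2 * n + j + 1)) =
  Q1 * Q2 * x ^+ 8 * y ^+ 4 * q ^+ 4 by qmono.
have -> : q ^+ (2 * e.+1 * (2 * n + j + 1)) =
  Q1 * Q2 * x ^+ 4 * y ^+ 2 * q ^+ 2 by qmono.
have -> : q ^+ (2 * e * (2 * n + j + 1)) = Q1 * Q2 by qmono.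
have -> : q ^+ (2 * n + 1) = x ^+ 2 * q ^+ 1 by qmono.
have -> : q ^+ (2 * n) = x ^+ 2 by qmono.
by ring.
Qed.

End ShelfTerms.

(** * Induction over the shelves *)

Section Shelves.
Set Implicit Arguments.
Unset Strict Implicit.
Variables (R : comNzRingType).
Local Notation q := (qvar R).

(** With u = q^(2n+1), the bracket factors as (1 + u)(1 - P u): the first factor cancels the only
    denominator and the second is that of the triple product. *)
Lemma Fprod_Gprod_shelf0 k i : (1 <= i <= k)%N ->
  Fprod R * Gprod R k i = lsum (shelf_term R k 0 i).
Proof.
move=> ik; rewrite Fprod_Gprod //; congr lsum; apply/funext => n.
have [d kE] : exists d, k = (i + d)%N by exists (k - i)%N; lia.
have -> : (2 * k - (2 * i - 1) = 2 * d + 1)%N by lia.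
rewrite /shelf_term /shelf_num big_geq // /shelf_den big_nat1 !addn0.
have -> : (k - i = d)%N by lia.
set u := q ^+ (2 * n + 1); set P := q ^+ (2 * d * (2 * n + 1)).
have uu : 1 + u \is a GRing.unit by apply/unit_sub1/add1qX_sub1; lia.
have -> : q ^+ (2 * (d + 1) * (2 * n + 1)) = P * u ^+ 2.
  by rewrite -exprM -exprD; congr (_ ^+ _); nia.
have -> : q ^+ ((2 * d + 1) * n.*2.+1) = P * u.
  by rewrite -exprD; congr (_ ^+ _); nia.
have -> : 1 - P * u ^+ 2 + u * (1 - P) = (1 + u) * (1 - P * u) by ring.
have -> : ((2 * k + (2 * i - 1)) * 'C(n.+1, 2) + (2 * d + 1) * 'C(n, 2) =
    4 * k * 'C(n, 2) + (2 * k * (0 + 1) + 2 * i - 1) * n)%N.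
  by rewrite bin2S kE; have := bin2_sqr n; rewrite bin2S; nia.
by rewrite mulr1 mulrA (divrK uu).
Qed.

Lemma Fprod_shelf_sequence k (G : nat -> laurent R) j i :
  (2 <= k)%N -> shelf_sequence k G -> (1 <= i <= k)%N ->
  Fprod R * G ((k - 1) * j + i)%N = lsum (shelf_term R k j i).
Proof.
move=> k2 [G0 Grec]; elim: j i => [|j IHj].
  by move=> i ik; rewrite muln0 add0n G0 // Fprod_Gprod_shelf0.
case=> // i; elim: i => [|i IHi] ik.
  have -> : ((k - 1) * j.+1 + 1 = (k - 1) * j + k)%N by lia.
  have kk : (1 <= k <= k)%N by lia.
  have k0 : (0 < k)%N by lia.
  exact: etrans (IHj k kk) (esym (shelf_overlap R j k0)).
rewrite Grec //.
have -> : ((k - 1) * j.+1 + i.+2 - 1 = (k - 1) * j.+1 + i.+1)%N.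
  by rewrite addnS subn1.
have -> : (k - i.+2 + 1 = k - i.+1)%N by lia.
have -> : (k - i.+2 + 2 = (k - i.+1).+1)%N by lia.
have -> : (j.+1 - 1 = j)%N by lia.
have -> : (i.+2 - 1 = i.+1)%N by lia.
have ik1 : (1 <= i.+1 <= k)%N by lia.
have ik3 : (1 <= k - i.+1 <= k)%N by lia.
have ik4 : (1 <= (k - i.+1).+1 <= k)%N by lia.
have ek : (0 < i.+1 < k)%N by lia.
have qu := qvar_unit R; have Xu := qX_unit R (2 * j.+1 * i.+1).
move: (IHi ik1) (IHj _ ik3) (IHj _ ik4) (@shelf_recursion R k j _ ek).
move: (G _) (G _) (G _) (lsum _) (lsum _) (lsum _) (lsum _) =>
  G4 G3 G2 L1 L4 L3 L2.
move=> e2 e3 e4 rec.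
have -> : Fprod R * ((G3 - G4) / q ^+ (2 * j.+1 * i.+1) - q^-1 * G2) =
    (Fprod R * G3 - Fprod R * G4) / q ^+ (2 * j.+1 * i.+1) -
    q^-1 * (Fprod R * G2) by ring.
(* Inserting q^-1 q exposes the right-hand side of the cleared recursion. *)
rewrite e2 e3 e4 -(mulKr qu (L3 - L4)) -rec mulrCA [_ / _]mulrC mulKr //.
by rewrite mulrDr mulKr // addrK.
Qed.

End Shelves.

Theorem theorem3p1 (R : comNzRingType) (k : nat) (G : nat -> laurent R)
    (hk : (2 <= k)%N) (hG : shelf_sequence k G) (j i : nat)
    (hi : (1 <= i <= k)%N) :
  let q := qvar R in
  G ((k - 1) * j + i)%N =
    1 / Fprod R *
    \lsum_(n >= 0)
      ((-1) ^+ n * q ^+ (4 * k * 'C(n, 2) + (2 * k * (j + 1) + 2 * i - 1) * n)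
         * (\prod_(1 <= t < j.+1) (1 - q ^+ (2 * (n + t))))
         / (\prod_(0 <= t < j.+1) (1 + q ^+ (2 * (n + t) + 1)))
       * (1 - q ^+ (2 * (k - i + 1) * (2 * n + j + 1))
            + q ^+ (2 * (n + j) + 1)
              * (1 - q ^+ (2 * (k - i) * (2 * n + j + 1))))).
Proof.
move=> q; rewrite -[lsum _]/(lsum (shelf_term R k j i)).
by rewrite -(Fprod_shelf_sequence j hk hG hi) div1r mulKr // Fprod_unit.
Qed.
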